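(* The theory of the structure $\langle\mathbb{C},0,1,-1,\cdot,{}^{-1},\omega_3,\omega_4,\ldots\rangle$ admits quantifier elimination.
   Context: $\mathbb{C}$ carries constants $0,1,-1$, ordinary multiplication, ${}^{-1}$ given by $x^{-1}=1/x$ for $x\neq 0$ and $0^{-1}=0$, and for each $n\geq 3$ a constant $\omega_n=\cos(2\pi/n)+i\sin(2\pi/n)$ (a primitive $n$-th root of unity). *)

(* Defs.v *)
From mathcomp Require Import all_boot all_order all_algebra.
From mathcomp Require Import complex.
From mathcomp Require Import reals trigo.

Set Implicit Arguments.
Unset Strict Implicit.
Unset Printing Implicit Defensive.

Import GRing.Theory Num.Theory.
Local Open Scope ring_scope.

Record language := Language {
  fsym : Type;
  farity : fsym -> nat;
  rsym : Type;
  rarity : rsym -> nat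
}.

Record structure (L : language) := Structure {
  carrier :> Type;
  carrier_nonempty : inhabited carrier;
  finterp : forall f : fsym L, ('I_(farity f) -> carrier) -> carrier;
  rinterp : forall r : rsym L, ('I_(rarity r) -> carrier) -> Prop
}.

(* Formulas are well-scoped: [term L n] and [formula L n] have their free
   variables among v_0, ..., v_(n-1).  Under a quantifier, v_0 is the bound
   variable and the outer variables are shifted by one. *)
Inductive term (L : language) (n : nat) : Type :=
| Var of 'I_n
| App (f : fsym L) of ('I_(farity f) -> term L n).

Inductive formula (L : language) : nat -> Type :=
| Bot n : formula L n
| Equ n of term L n & term L n : formula L n
| Rel n (r : rsym L) of ('I_(rarity r) -> term L n) : formula L n
| Neg n of formula L n : formula L n
| And n of formula L n & formula L n : formula L n
| Or n of formula L n & formula L n : formula L n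
| Imp n of formula L n & formula L n : formula L n
| All n of formula L n.+1 : formula L n
| Ex n of formula L n.+1 : formula L n.

Definition Iff (L : language) (n : nat) (p q : formula L n) : formula L n :=
  And (Imp p q) (Imp q p).

Definition sentence (L : language) : Type := formula L 0.

Fixpoint quantifier_free (L : language) (n : nat) (p : formula L n) : Prop :=
  match p with
  | Bot _ | Equ _ _ _ | Rel _ _ _ => True
  | Neg _ q => quantifier_free q
  | And _ q r | Or _ q r | Imp _ q r => quantifier_free q /\ quantifier_free r
  | All _ _ | Ex _ _ => False
  end.

Definition assignment (M : Type) (n : nat) : Type := 'I_n -> M.

Definition acons (M : Type) (n : nat) (x : M) (e : assignment M n) :
    assignment M n.+1 :=
  fun i => if unlift ord0 i is Some j then e j else x.

Fixpoint teval (L : language) (M : structure L) (n : nat)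
    (e : assignment M n) (t : term L n) : M :=
  match t with
  | Var i => e i
  | App f ts => @finterp L M f (fun i => teval e (ts i))
  end.

Fixpoint sat (L : language) (M : structure L) (n : nat) (p : formula L n) :
    assignment M n -> Prop :=
  match p in formula _ n return assignment M n -> Prop with
  | Bot _ => fun _ => False
  | Equ _ t u => fun e => teval e t = teval e u
  | Rel _ r ts => fun e => @rinterp L M r (fun i => teval e (ts i))
  | Neg _ q => fun e => ~ sat q e
  | And _ q r => fun e => sat q e /\ sat r e
  | Or _ q r => fun e => sat q e \/ sat r e
  | Imp _ q r => fun e => sat q e -> sat r e
  | All _ q => fun e => forall x : M, sat q (acons x e)
  | Ex _ q => fun e => exists x : M, sat q (acons x e)
  end.

Definition models (L : language) (M : structure L) (s : sentence L) : Prop :=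
  forall e : assignment M 0, sat s e.

Definition theory (L : language) : Type := sentence L -> Prop.

Definition theory_of (L : language) (M : structure L) : theory L :=
  fun s => models M s.

Definition is_model (L : language) (M : structure L) (T : theory L) : Prop :=
  forall s : sentence L, T s -> models M s.

Definition entails (L : language) (T : theory L) (n : nat) (p : formula L n) :
    Prop :=
  forall M : structure L, is_model M T -> forall e : assignment M n, sat p e.

Definition admits_QE (L : language) (T : theory L) : Prop :=
  forall (n : nat) (p : formula L n),
    exists q : formula L n, quantifier_free q /\ entails T (Iff p q).

Inductive cmul_sym : Type :=
| Zero_sym
| One_sym
| MinusOne_sym
| Mul_sym
| Inv_sym
| Omega_sym (n : nat) of (2 < n)%N.

Definition cmul_arity (f : cmul_sym) : nat :=
  match f with
  | Zero_sym | One_sym | MinusOne_sym | Omega_sym _ _ => 0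
  | Mul_sym => 2
  | Inv_sym => 1
  end.

Definition cmul_language : language :=
  {| fsym := cmul_sym; farity := cmul_arity;
     rsym := Empty_set; rarity := fun r => match r with end |}.

Definition omega (R : realType) (n : nat) : R[i] :=
  Complex (cos (2 * pi / n%:R)) (sin (2 * pi / n%:R)).

(* In the field R[i], the library's inverse satisfies 0^-1 = 0 (invr0). *)
Definition cmul_interp (R : realType) (f : cmul_sym) :
    ('I_(cmul_arity f) -> R[i]) -> R[i] :=
  match f return ('I_(cmul_arity f) -> R[i]) -> R[i] with
  | Zero_sym => fun _ => 0
  | One_sym => fun _ => 1
  | MinusOne_sym => fun _ => -1
  | Mul_sym => fun x => x ord0 * x ord_max
  | Inv_sym => fun x => (x ord0)^-1
  | Omega_sym n _ => fun _ => omega R n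
  end.

Definition cmul_structure (R : realType) : structure cmul_language :=
  {| carrier := R[i];
     carrier_nonempty := inhabits 0;
     finterp := @cmul_interp R : forall f : fsym cmul_language,
       ('I_(farity f) -> R[i]) -> R[i];
     rinterp := fun r : rsym cmul_language => match r with end |}.

(* Main.v *)
Require Import Defs.
From mathcomp Require Import all_boot all_order all_algebra.
From mathcomp Require Import complex.
From mathcomp Require Import reals.
From mathcomp Require Import boolp separable ring.

(** The theory is complete, so it suffices to eliminate one existential
    quantifier in the complex numbers themselves.  The case [x = 0] is a
    substitution.  For [x != 0] every term is [s(y) * x^a / x^b], so a
    quantifier-free formula becomes a disjunction of conjunctions of literals
    [x^m = u(y)] and [x^m <> u(y)].  If a conjunction has an equation
    [x^a = u] with [a > 0], one counts its solutions: by Bezout, [x^a = u] and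
    [x^b = v] together amount to one equation [x^gcd(a,b) = w] plus conditions
    on the parameters; an inequation is handled by subtracting the number of
    solutions of the corresponding equation; and [x^a = u] has exactly [a]
    solutions when [u <> 0].  Otherwise [x] only has to avoid finitely many
    values. *)

Set Implicit Arguments.
Unset Strict Implicit.
Unset Printing Implicit Defensive.

Import GRing.Theory Num.Theory.
Local Open Scope ring_scope.

(** * Roots of [x^a = u] in an algebraically closed field of characteristic 0 *)

Section ClosedField.

Variable F : numClosedFieldType.
Implicit Types (x u v w : F) (a b m : nat).

(** [X] times the derivative minus [a] times the polynomial is the constant [a * u], which is
    nonzero in characteristic 0. *)
Lemma separable_XnsubC a u : (0 < a)%N -> u != 0 ->
  separable_poly ('X^a - u%:P : {poly F}).
Proof.
case: a => // a _ u0; rewrite unlock derivB derivC subr0 derivXn /=.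
have au0 : a.+1%:R * u != 0 by rewrite mulf_neq0 ?pnatr_eq0.
apply/Bezout_coprimepP; exists (- a.+1%:R%:P, 'X); rewrite /=.
suff -> : - a.+1%:R%:P * ('X^(a.+1) - u%:P) + 'X * ('X^a *+ a.+1) =
    (a.+1%:R * u)%:P :> {poly F} by rewrite polyC_eqp1.
rewrite -mulr_natl polyCM polyC_natr exprS; ring.
Qed.

(** For [u = 0] and [a > 0] the only root is 0, hence the empty list. With this choice the list is
    duplicate-free for every [u]. *)
Definition nonzero_roots a u : seq F :=
  if u == 0 then [::] else sval (closed_field_poly_normal ('X^a - u%:P)).

Lemma XnsubC_factors a u : (0 < a)%N -> u != 0 ->
  'X^a - u%:P = \prod_(z <- nonzero_roots a u) ('X - z%:P).
Proof.
move=> a0 u0; rewrite /nonzero_roots (negPf u0).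
case: closed_field_poly_normal => r /= {1}->.
by rewrite lead_coefXnsubC // scale1r.
Qed.

Lemma uniq_nonzero_roots a u : (0 < a)%N -> uniq (nonzero_roots a u).
Proof.
move=> a0; have [->|u0] := eqVneq u 0; first by rewrite /nonzero_roots eqxx.
by rewrite -separable_prod_XsubC -XnsubC_factors // separable_XnsubC.
Qed.

Lemma size_nonzero_roots a u : (0 < a)%N ->
  size (nonzero_roots a u) = if u == 0 then 0 else a.
Proof.
move=> a0; have [->|u0] := eqVneq u 0; first by rewrite /nonzero_roots eqxx.
apply: succn_inj; rewrite -(size_prod_XsubC _ id) -XnsubC_factors //.
by rewrite size_XnsubC.
Qed.

Lemma mem_nonzero_roots a u x : (0 < a)%N ->
  (x \in nonzero_roots a u) = (x != 0) && (x ^+ a == u).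
Proof.
move=> a0; have [->|u0] := eqVneq u 0.
  by rewrite /nonzero_roots eqxx in_nil expf_eq0 a0 /= andNb.
rewrite -root_prod_XsubC -XnsubC_factors // rootE !hornerE subr_eq0.
have [->|//] := eqVneq x 0.
by rewrite expr0n eqn0Ngt a0 /= eq_sym (negPf u0).
Qed.

(** For [a > 0], [egcdn a b] is a pair [(s, t)] with [s * a = t * b + gcdn a b]. So this is the
    value forced on [x ^ gcdn a b] when [x^a = u], [x^b = v] and [x != 0]. *)
Definition bezout_root a b u v : F :=
  u ^+ (egcdn a b).1 / v ^+ (egcdn a b).2.

(** The solvability condition, free of [x]. It also covers [b = 0], where the gcd is [a] and the
    second equation becomes [1 = v]. *)
Definition bezout_compatible a b u v : bool :=
  (bezout_root a b u v ^+ (a %/ gcdn a b) == u) &&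
  (bezout_root a b u v ^+ (b %/ gcdn a b) == v).

Lemma expr_eq_gcd a b u v x : (0 < a)%N -> x != 0 ->
  (x ^+ a == u) && (x ^+ b == v) =
  bezout_compatible a b u v && (x ^+ gcdn a b == bezout_root a b u v).
Proof.
move=> a0 x0.
have xa : (x ^+ gcdn a b) ^+ (a %/ gcdn a b) = x ^+ a.
  by rewrite -exprM mulnC divnK ?dvdn_gcdl.
have xb : (x ^+ gcdn a b) ^+ (b %/ gcdn a b) = x ^+ b.
  by rewrite -exprM mulnC divnK ?dvdn_gcdr.
apply/idP/idP=> [/andP[/eqP ua /eqP vb]|]; last first.
  by move=> /andP[+ /eqP xw]; rewrite /bezout_compatible -xw xa xb.
have xw : x ^+ gcdn a b = bezout_root a b u v.
  rewrite /bezout_root -ua -vb; case: (egcdnP b a0) => s t /= est _.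
  by rewrite -!exprM (mulnC a) est (mulnC b) exprD mulrAC divff ?mul1r ?expf_neq0.
by rewrite /bezout_compatible -xw xa xb ua vb !eqxx.
Qed.

(** Under compatibility, both filtered root lists are duplicate-free with the same members. The
    predicate [p] will hold the literals still to be treated. *)
Lemma count_roots_eq a b u v (p : pred F) : (0 < a)%N ->
  count (fun x => (x ^+ b == v) && p x) (nonzero_roots a u) =
  if bezout_compatible a b u v
  then count p (nonzero_roots (gcdn a b) (bezout_root a b u v)) else 0.
Proof.
move=> a0; have d0 : (0 < gcdn a b)%N by rewrite gcdn_gt0 a0.
have mem x : (x \in nonzero_roots a u) && (x ^+ b == v) =
    bezout_compatible a b u v &&
    (x \in nonzero_roots (gcdn a b) (bezout_root a b u v)).
  rewrite !mem_nonzero_roots //; have [->|x0] := eqVneq x 0.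
    by rewrite andbF.
  by rewrite /= expr_eq_gcd.
case: ifP => C; last first.
  apply/eqP; rewrite -leqn0 leqNgt -has_count; apply/negP.
  move=> /hasP[x xr /andP[xb _]].
  by have := mem x; rewrite xr xb C.
rewrite -!size_filter; apply/perm_size/uniq_perm.
- by rewrite filter_uniq ?uniq_nonzero_roots.
- by rewrite filter_uniq ?uniq_nonzero_roots.
move=> x; rewrite !mem_filter; have := mem x; rewrite C /= => <-.
by rewrite andbAC andbC (andbC (_ == v)).
Qed.

Lemma count_roots_neq a b u v (p : pred F) :
  count p (nonzero_roots a u) =
  (count (fun x => (x ^+ b == v) && p x) (nonzero_roots a u) +
   count (fun x => (x ^+ b != v) && p x) (nonzero_roots a u))%N.
Proof.
elim: (nonzero_roots a u) => //= x s ->.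
by case: (_ == v); case: (p x); rewrite /= ?addnS ?addSn.
Qed.

(** The product of [X] and all [X^m - u] with [m > 0] is a nonzero polynomial, so it has a
    non-root. *)
Lemma exists_avoiding_powers (s : seq (nat * F)) :
  exists2 x, x != 0 & all (fun mu => (mu.1 == 0%N) || (x ^+ mu.1 != mu.2)) s.
Proof.
pose f (mu : nat * F) : {poly F} :=
  if mu.1 == 0%N then 1 else 'X^(mu.1) - mu.2%:P.
have /closed_nonrootP[x] : 'X * \prod_(mu <- s) f mu != 0.
  rewrite mulf_neq0 ?polyX_eq0 // prodf_seq_neq0; apply/allP => -[m u] _ /=.
  rewrite /f /=; case: ifPn => [_|m0]; first exact: oner_neq0.
  by rewrite -size_poly_gt0 size_XnsubC // lt0n.
rewrite rootM rootX negb_or => /andP[x0 xs]; exists x => //.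
move: xs; rewrite rootE horner_prod prodf_seq_neq0.
apply: sub_all => -[m u] /=; rewrite /f /=; case: (m == 0%N) => //=.
by rewrite !hornerE subr_eq0.
Qed.

End ClosedField.

(** * Terms and quantifier-free definable conditions on the parameters *)

Section Elimination.

Variable R : realType.
Local Notation C := R[i].
Local Notation L := cmul_language.
Local Notation M := (cmul_structure R).
Local Notation tm := (term L).
Local Notation asg := (assignment C).

Definition ev n (y : asg n) (t : tm n) : C := teval (M := M) y t.

Definition tzero n : tm n :=
  @App L n Zero_sym (fun i : 'I_0 => False_rect _ (notF (valP i))).
Definition tone n : tm n :=
  @App L n One_sym (fun i : 'I_0 => False_rect _ (notF (valP i))).
Definition tmul n (s t : tm n) : tm n :=
  @App L n Mul_sym (fun i : 'I_2 => if i == ord0 then s else t).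
Definition tinv n (s : tm n) : tm n := @App L n Inv_sym (fun i : 'I_1 => s).
Definition texp n (s : tm n) k : tm n := iter k (tmul s) (tone n).

Lemma ev_zero n (y : asg n) : ev y (tzero n) = 0. Proof. by []. Qed.
Lemma ev_one n (y : asg n) : ev y (tone n) = 1. Proof. by []. Qed.
Lemma ev_mul n (y : asg n) s t : ev y (tmul s t) = ev y s * ev y t.
Proof. by []. Qed.
Lemma ev_inv n (y : asg n) s : ev y (tinv s) = (ev y s)^-1.
Proof. by []. Qed.
Lemma ev_exp n (y : asg n) s k : ev y (texp s k) = ev y s ^+ k.
Proof. by elim: k => //= k IH; rewrite ev_mul IH exprS. Qed.

Definition evE := (ev_zero, ev_one, ev_mul, ev_inv, ev_exp).

(** A semantic notion, so that formulas can be replaced by any equivalent condition without being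
    written out. *)
Definition qf_definable n (P : asg n -> Prop) : Prop :=
  exists2 q : formula L n, quantifier_free q &
    forall y : asg n, sat (M := M) q y <-> P y.

Lemma qf_ext n (P Q : asg n -> Prop) :
  (forall y, P y <-> Q y) -> qf_definable P -> qf_definable Q.
Proof. by move=> PQ [q qf qP]; exists q => // y; rewrite qP. Qed.

Lemma qf_false n : qf_definable (fun _ : asg n => False).
Proof. by exists (Bot L n). Qed.

Lemma qf_not n (P : asg n -> Prop) :
  qf_definable P -> qf_definable (fun y => ~ P y).
Proof. by move=> [q qf qP]; exists (Neg q) => // y /=; rewrite qP. Qed.

Lemma qf_true n : qf_definable (fun _ : asg n => True).
Proof. by apply: qf_ext (qf_not (qf_false n)) => y; tauto. Qed.

Lemma qf_and n (P Q : asg n -> Prop) :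
  qf_definable P -> qf_definable Q -> qf_definable (fun y => P y /\ Q y).
Proof.
by move=> [p fp pP] [q fq qQ]; exists (And p q) => // y /=; rewrite pP qQ.
Qed.

Lemma qf_or n (P Q : asg n -> Prop) :
  qf_definable P -> qf_definable Q -> qf_definable (fun y => P y \/ Q y).
Proof.
by move=> [p fp pP] [q fq qQ]; exists (Or p q) => // y /=; rewrite pP qQ.
Qed.

Lemma qf_imp n (P Q : asg n -> Prop) :
  qf_definable P -> qf_definable Q -> qf_definable (fun y => P y -> Q y).
Proof.
by move=> [p fp pP] [q fq qQ]; exists (Imp p q) => // y /=; rewrite pP qQ.
Qed.

Lemma qf_const n (P : Prop) : qf_definable (fun _ : asg n => P).
Proof.
case: (pselect P) => p; [apply: qf_ext (qf_true n)|apply: qf_ext (qf_false n)];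
  by move=> _; tauto.
Qed.

Lemma qf_eq n (s t : tm n) : qf_definable (fun y => ev y s = ev y t).
Proof. by exists (Equ s t). Qed.

Lemma qf_exists_lt n m (P : nat -> asg n -> Prop) :
  (forall i, qf_definable (P i)) ->
  qf_definable (fun y => exists2 i, (i < m)%N & P i y).
Proof.
move=> qP; elim: m => [|m IH].
  by apply: qf_ext (qf_false n) => y; split=> [[]|[]].
apply: qf_ext (qf_or IH (qP m)) => y; split.
  move=> [[i im Pi]|Pm]; last by exists m.
  by exists i => //; apply: ltnW.
move=> [j]; rewrite ltnS leq_eqVlt => /orP[/eqP -> Pm|jm Pj]; first by right.
by left; exists j.
Qed.

Lemma term_subst m n (f : asg n -> asg m) :
  (forall i, exists t, forall y, ev y t = f y i) ->
  forall t, exists t', forall y, ev y t' = ev (f y) t.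
Proof.
move=> fP; elim=> [i|[ | | | | |k k2] ts IH]; first exact: fP.
- by exists (tzero n).
- by exists (tone n).
- by exists (@App L n MinusOne_sym
    (fun i : 'I_0 => False_rect _ (notF (valP i)))).
- have [s sP] := IH ord0; have [t tP] := IH ord_max.
  by exists (tmul s t) => y; rewrite evE sP tP.
- have [s sP] := IH ord0.
  by exists (tinv s) => y; rewrite evE sP.
- by exists (@App L n (Omega_sym k2)
    (fun i : 'I_0 => False_rect _ (notF (valP i)))).
Qed.

Lemma qf_subst m n (f : asg n -> asg m) (p : formula L m) :
  quantifier_free p -> (forall i, exists t, forall y, ev y t = f y i) ->
  qf_definable (fun y => sat (M := M) p (f y)).
Proof.
elim: p f => {m} [m |m s t|m []|m p IH|m p IHp q IHq|m p IHp q IHq|m p IHp q IHq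
    |//|//] f /=.
- by move=> _ _; apply: qf_false.
- move=> _ fP; have [s' sP] := term_subst fP s; have [t' tP] := term_subst fP t.
  by apply: qf_ext (qf_eq s' t') => y; rewrite sP tP.
- by move=> qp fP; apply/qf_not/IH.
- by move=> [qp qq] fP; apply: qf_and; [apply: IHp|apply: IHq].
- by move=> [qp qq] fP; apply: qf_or; [apply: IHp|apply: IHq].
- by move=> [qp qq] fP; apply: qf_imp; [apply: IHp|apply: IHq].
Qed.

(** * Counting the solutions of a conjunction of literals *)

(* [(b, m, t)] stands for [x ^ m = t] if [b] and for [x ^ m <> t] otherwise;
   with [m = 0] it is a condition on the parameters only. *)
Definition literal n : Type := (bool * nat * tm n)%type.

Definition lit n (x : C) (y : asg n) (l : literal n) : bool :=
  (x ^+ l.1.2 == ev y l.2) == l.1.1.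

(** Induction on [l] with [a], [u] and [k] general: an equation replaces [(a, u)] by the gcd and the
    Bezout root, which is again the value of a term. *)
Lemma qf_count n (l : seq (literal n)) a (u : tm n) k : (0 < a)%N ->
  qf_definable (fun y =>
    count (fun x => all (lit x y) l) (nonzero_roots a (ev y u)) = k).
Proof.
elim: l a u k => [|[[b m] v] l IH] a u k a0.
  apply: (@qf_ext _ (fun y => (ev y u = ev y (tzero n) /\ 0 = k) \/
      (ev y u <> ev y (tzero n) /\ a = k))).
    move=> y; rewrite count_predT size_nonzero_roots // ev_zero.
    by case: eqVneq => [->|/eqP u0]; split; tauto.
  by apply: qf_or; apply: qf_and; try exact: qf_const;
    try apply: qf_not; apply: qf_eq.
pose w := tmul (texp u (egcdn a m).1) (tinv (texp v (egcdn a m).2)).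
have wE y : ev y w = bezout_root a m (ev y u) (ev y v).
  by rewrite /w !evE.
have qc : qf_definable (fun y => bezout_compatible a m (ev y u) (ev y v)).
  apply: qf_ext (qf_and (qf_eq (texp w (a %/ gcdn a m)) u)
    (qf_eq (texp w (m %/ gcdn a m)) v)) => y.
  rewrite !ev_exp wE /bezout_compatible; split; first by move=> [-> ->]; rewrite !eqxx.
  by move=> /andP[/eqP -> /eqP ->].
have qeq j : qf_definable (fun y => count (fun x => (x ^+ m == ev y v) &&
    all (lit x y) l) (nonzero_roots a (ev y u)) = j).
  have d0 : (0 < gcdn a m)%N by rewrite gcdn_gt0 a0.
  apply: qf_ext (qf_or (qf_and qc (IH _ w j d0))
    (qf_and (qf_not qc) (qf_const n (0 = j)))) => y.
  rewrite count_roots_eq // -wE.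
  by case: bezout_compatible; split; intuition.
case: b.
  apply: qf_ext (qeq k) => y; suff /eq_count -> : (fun x =>
    all (lit x y) ((true, m, v) :: l)) =1
    (fun x => (x ^+ m == ev y v) && all (lit x y) l) by [].
  by move=> x; rewrite /= /lit /= eqb_id.
(* The inequation leaves [k] solutions iff, for some [i], the tail [l] has [i + k] solutions and [i]
   of them satisfy the equation; [i <= a] as there are at most [a] roots. *)
have q i := qf_and (IH a u (i + k)%N a0) (qeq i).
apply: qf_ext (qf_exists_lt a.+1 q) => y.
have /eq_count -> : (fun x => all (lit x y) ((false, m, v) :: l)) =1
    (fun x => (x ^+ m != ev y v) && all (lit x y) l).
  by move=> x; rewrite /= /lit /= eqbF_neg.
rewrite (count_roots_neq _ m _ (ev y v)); split.
  by move=> [i _ [+ ei]]; rewrite ei => /addnI.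
move=> <-; eexists; last by split; first reflexivity.
rewrite ltnS (leq_trans (count_size _ _)) // size_nonzero_roots //.
by case: ifP.
Qed.

Lemma qf_all n T (s : seq T) (P : T -> asg n -> bool) :
  (forall c, qf_definable (fun y => P c y)) ->
  qf_definable (fun y => all (P ^~ y) s).
Proof.
move=> qP; elim: s => [|c s IH]; first exact: (qf_const n true).
by apply: qf_ext (qf_and (qP c) IH) => y /=; split=> /andP.
Qed.

Lemma qf_exists_clause n (l : seq (literal n)) :
  qf_definable (fun y => exists2 x : C, x != 0 & all (lit x y) l).
Proof.
pose eqn (c : literal n) := c.1.1 && (0 < c.1.2)%N.
(* With an equation [x^a = u], [a > 0], the clause is solvable iff the number of roots satisfying
   the other literals is not 0. *)
have [] := boolP (has eqn l).
  move=> /split_find[[[b a] u] l1 l2 /=]; rewrite /eqn /=; case: b => //= a0 _.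
  apply: qf_ext (qf_not (qf_count (l1 ++ l2) u 0 a0)) => y.
  split.
    move/eqP; rewrite -lt0n -has_count => /hasP[x].
    rewrite mem_nonzero_roots // => /andP[x0 xa]; rewrite all_cat => /andP[h1 h2].
    by exists x; rewrite // all_cat all_rcons h1 h2 /lit /= xa.
  move=> [x x0]; rewrite all_cat all_rcons {1}/lit /= eqb_id => /andP[/andP[xa h1] h2].
  apply/eqP; rewrite -lt0n -has_count; apply/hasP; exists x.
    by rewrite mem_nonzero_roots ?x0.
  by rewrite all_cat h1.
rewrite -all_predC => no_eqn.
(* Only literals of exponent 0 restrict [y]; they do not depend on [x], so they are evaluated at 1.
   The others are inequations, which a suitable [x] avoids simultaneously. *)
pose param (c : literal n) (y : asg n) := (0 < c.1.2)%N || lit 1 y c.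
have qparam c : qf_definable (fun y => param c y).
  case: c => [[b m] u]; rewrite /param /lit /=.
  have [_|_] := ltnP 0 m; first exact: (qf_const n true).
  have q := qf_eq (tone n) u; case: b.
    by apply: qf_ext q => y; rewrite expr1n eqb_id ev_one; split=> /eqP.
  by apply: qf_ext (qf_not q) => y; rewrite expr1n eqbF_neg ev_one; split=> /eqP.
apply: qf_ext (qf_all l qparam) => y; split.
  have [x x0 xl] := exists_avoiding_powers [seq (c.1.2, ev y c.2) | c <- l].
  move=> py; exists x => //; move: py xl no_eqn.
  elim: l => //= -[[b m] u] l IH /andP[pc pl] /andP[xc xl] /andP[ec el].
  rewrite IH // andbT; move: pc xc ec; rewrite /param /lit /eqn /=.
  case: m => [|m] /=; first by rewrite !expr0.
  by case: b => //= _ /negPf ->.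
move=> [x x0]; apply: sub_all => -[[b m] u]; rewrite /param /lit /=.
by case: m => //=; rewrite !expr0.
Qed.

(** * Disjunctive normal form in a nonzero variable *)

Definition dnf n (P : C -> asg n -> Prop) : Prop :=
  exists d : seq (seq (literal n)), forall x y, x != 0 ->
    (P x y <-> has (all (lit x y)) d).

Lemma dnf_ext n (P Q : C -> asg n -> Prop) :
  (forall x y, x != 0 -> P x y <-> Q x y) -> dnf P -> dnf Q.
Proof. by move=> PQ [d dP]; exists d => x y x0; rewrite -PQ // dP. Qed.

Lemma dnf_false n : dnf (fun _ (_ : asg n) => False).
Proof. by exists [::]. Qed.

Lemma dnf_true n : dnf (fun _ (_ : asg n) => True).
Proof. by exists [:: [::]]. Qed.

Lemma dnf_lit n (c : literal n) : dnf (fun x y => lit x y c).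
Proof. by exists [:: [:: c]] => x y _ /=; rewrite andbT orbF. Qed.

Lemma dnf_or n (P Q : C -> asg n -> Prop) :
  dnf P -> dnf Q -> dnf (fun x y => P x y \/ Q x y).
Proof.
move=> [d dP] [e eQ]; exists (d ++ e) => x y x0.
by rewrite has_cat dP // eQ //; split=> /orP.
Qed.

Lemma dnf_and n (P Q : C -> asg n -> Prop) :
  dnf P -> dnf Q -> dnf (fun x y => P x y /\ Q x y).
Proof.
move=> [d dP] [e eQ]; exists [seq c1 ++ c2 | c1 <- d, c2 <- e] => x y x0.
rewrite dP // eQ //.
suff -> : has (all (lit x y)) [seq c1 ++ c2 | c1 <- d, c2 <- e] =
    has (all (lit x y)) d && has (all (lit x y)) e by split=> /andP.
elim: d {dP} => //= c d IH; rewrite has_cat IH has_map.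
rewrite (eq_has (a2 := fun c' => all (lit x y) c && all (lit x y) c')); last first.
  by move=> c' /=; rewrite all_cat.
case: (all (lit x y) c) => /=; last by rewrite has_pred0.
by case: (has _ e); rewrite ?andbT ?andbF.
Qed.

Lemma qf_exists_dnf n (P : C -> asg n -> Prop) :
  dnf P -> qf_definable (fun y => exists2 x : C, x != 0 & P x y).
Proof.
move=> [d dP]; apply: (@qf_ext _ (fun y => exists2 x : C, x != 0 &
    has (all (lit x y)) d)).
  by move=> y; split=> -[x x0 h]; exists x => //; apply/dP.
elim: d {dP} => [|c d IH].
  by apply: qf_ext (qf_false n) => y; split=> [|[]].
apply: qf_ext (qf_or (qf_exists_clause c) IH) => y; split.
  by move=> [] [x x0 h]; exists x; rewrite //= h ?orbT.
by move=> [x x0 /= /orP[]]; [left|right]; exists x.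
Qed.

(* [s <> 0] is written [x ^ 0 = s / s]. *)
Lemma dnf_neq0 n (s : tm n) : dnf (fun _ y => ev y s <> 0).
Proof.
apply: dnf_ext (dnf_lit (true, 0%N, tmul s (tinv s))) => x y x0.
rewrite /lit /= !evE eqb_id expr0; have [->|s0] := eqVneq (ev y s) 0.
  by rewrite mul0r oner_eq0; split.
by rewrite divff // eqxx; split => // _; apply/eqP.
Qed.

Lemma dnf_eq0 n (s : tm n) : dnf (fun _ y => ev y s = 0).
Proof.
apply: dnf_ext (dnf_lit (false, 0%N, tmul s (tinv s))) => x y x0.
rewrite /lit /= !evE eqbF_neg expr0; have [->|s0] := eqVneq (ev y s) 0.
  by rewrite mul0r oner_eq0; split.
by rewrite divff // eqxx; split => // /eqP; rewrite (negPf s0).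
Qed.

(** Where [s] is nonzero, dividing by it gives a literal with right side [t / s]; where [s]
    vanishes, only the condition [t = 0] remains. *)
Lemma dnf_monomial_eq n (s t : tm n) m :
  dnf (fun x y => ev y s * x ^+ m = ev y t) /\
  dnf (fun x y => ev y s * x ^+ m <> ev y t).
Proof.
pose r := tmul t (tinv s).
have rE x y : ev y s != 0 ->
    (x ^+ m == ev y r) = (ev y s * x ^+ m == ev y t).
  by move=> s0; rewrite !evE eq_sym -(inj_eq (mulfI s0)) mulrCA divff // mulr1 eq_sym.
split.
  apply: dnf_ext (dnf_or (dnf_and (dnf_neq0 s) (dnf_lit (true, m, r)))
    (dnf_and (dnf_eq0 s) (dnf_eq0 t))) => x y x0.
  rewrite /lit /= eqb_id; have [s0|s0] := eqVneq (ev y s) 0.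
    by rewrite s0 mul0r; split; [move=> [[]//|[_ ->]]|right].
  rewrite rE // -(rwP eqP); move/eqP: s0; tauto.
apply: dnf_ext (dnf_or (dnf_and (dnf_neq0 s) (dnf_lit (false, m, r)))
  (dnf_and (dnf_eq0 s) (dnf_neq0 t))) => x y x0.
rewrite /lit /= eqbF_neg; have [s0|s0] := eqVneq (ev y s) 0.
  rewrite s0 mul0r; split; first by move=> [[]//|[_ ts]] /esym.
  by move=> ts; right; split=> // /esym.
rewrite rE //; move: (ev y s * _) (ev y t) => p q.
have -> : (p != q) <-> (p <> q) by split=> /eqP.
by move/eqP: s0; tauto.
Qed.

(** The quotient [x^a / x^b] encodes an integer power of [x] by natural exponents; inversion swaps
    them. *)
Definition monomial_form n (f : C -> asg n -> C) : Prop :=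
  exists (s : tm n) a b, forall x y, x != 0 ->
    f x y = ev y s * x ^+ a / x ^+ b.

Lemma dnf_eq n (f g : C -> asg n -> C) :
  monomial_form f -> monomial_form g ->
  dnf (fun x y => f x y = g x y) /\ dnf (fun x y => f x y <> g x y).
Proof.
move=> [s [a [b fE]]] [t [c [d gE]]].
(* Cross-multiplying gives [s * x^(a+d) = t * x^(c+b)]. By symmetry the left power may be taken as
   the larger, so the difference of exponents is not truncated. *)
wlog le : f g s t a b c d fE gE / (c + b <= a + d)%N.
  move=> H; case/orP: (leq_total (c + b) (a + d)) => le; first exact: H fE gE le.
  have [h1 h2] := H _ _ _ _ _ _ _ _ gE fE le.
  by split; [apply: dnf_ext h1|apply: dnf_ext h2] => x y _;
    split => h // /esym.
have eqE x y : x != 0 ->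
    (f x y = g x y) <-> (ev y s * x ^+ (a + d - (c + b)) = ev y t).
  move=> x0; have xn0 k : x ^+ k != 0 by rewrite expf_neq0.
  rewrite fE // gE //; transitivity (ev y s * x ^+ (a + d) = ev y t * x ^+ (c + b)).
    rewrite !exprD !mulrA; split; last by move=> h; apply/eqP; rewrite eqr_div ?h.
    by move/eqP; rewrite eqr_div // => /eqP.
  rewrite -{1}(subnK le) exprD mulrA; split; last by move=> ->.
  exact: mulIf.
have [h1 h2] := dnf_monomial_eq s t (a + d - (c + b)).
by split; [apply: dnf_ext h1|apply: dnf_ext h2] => x y x0; rewrite eqE.
Qed.

Lemma monomial_form_term m n (f : C -> asg n -> asg m) :
  (forall i, monomial_form (fun x y => f x y i)) ->
  forall t, monomial_form (fun x y => ev (f x y) t).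
Proof.
move=> fP; have const (s : tm n) : monomial_form (fun _ y => ev y s).
  by exists s, 0%N, 0%N => x y x0; rewrite expr0 divr1 mulr1.
elim=> [i|[ | | | | |k k2] ts IH]; first exact: fP.
- exact: (const (tzero n)).
- exact: (const (tone n)).
- exact: (const (@App L n MinusOne_sym
    (fun i : 'I_0 => False_rect _ (notF (valP i))))).
- have [s [a [b sP]]] := IH ord0; have [t [c [d tP]]] := IH ord_max.
  exists (tmul s t), (a + c)%N, (b + d)%N => x y x0.
  rewrite -[LHS]/(ev (f x y) (ts ord0) * ev (f x y) (ts ord_max)).
  by rewrite sP // tP // ev_mul !exprD invfM mulrACA (mulrACA (ev y s)).
- have [s [a [b sP]]] := IH ord0.
  exists (tinv s), b, a => x y x0.
  rewrite -[LHS]/((ev (f x y) (ts ord0))^-1) sP // ev_inv !invfM invrK.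
  by rewrite mulrAC.
- exact: (const (@App L n (Omega_sym k2)
    (fun i : 'I_0 => False_rect _ (notF (valP i))))).
Qed.

(** A formula and its negation are treated together, so that negation only swaps the two halves and
    no disjunctive form has to be negated. *)
Lemma dnf_formula m n (f : C -> asg n -> asg m) (p : formula L m) :
  quantifier_free p -> (forall i, monomial_form (fun x y => f x y i)) ->
  dnf (fun x y => sat (M := M) p (f x y)) /\
  dnf (fun x y => ~ sat (M := M) p (f x y)).
Proof.
elim: p f => {m} [m |m s t|m []|m p IH|m p IHp q IHq|m p IHp q IHq|m p IHp q IHq
    |//|//] f /=.
- move=> _ _; split; first exact: dnf_false.
  by apply: dnf_ext (dnf_true n) => x y _; tauto.
- by move=> _ fP; apply: dnf_eq; apply: monomial_form_term.
- move=> qp /(IH f qp)[h1 h2]; split => //.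
  by apply: dnf_ext h1 => x y _; rewrite notK.
- move=> [qp qq] fP; have [p1 p2] := IHp f qp fP; have [q1 q2] := IHq f qq fP.
  split; first exact: dnf_and.
  by apply: dnf_ext (dnf_or p2 q2) => x y _; rewrite not_andP.
- move=> [qp qq] fP; have [p1 p2] := IHp f qp fP; have [q1 q2] := IHq f qq fP.
  split; first exact: dnf_or.
  by apply: dnf_ext (dnf_and p2 q2) => x y _; rewrite not_orP.
- move=> [qp qq] fP; have [p1 p2] := IHp f qp fP; have [q1 q2] := IHq f qq fP.
  split; first by apply: dnf_ext (dnf_or p2 q1) => x y _; rewrite implyE.
  by apply: dnf_ext (dnf_and p1 q2) => x y _; rewrite not_implyP.
Qed.

(** * Quantifier elimination in the complex numbers *)

Lemma qf_exists n (P : asg n.+1 -> Prop) :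
  qf_definable P -> qf_definable (fun y => exists x : C, P (acons x y)).
Proof.
move=> [p qp pP].
have at0 : qf_definable (fun y => sat (M := M) p (acons 0 y)).
  apply: qf_subst qp _ => i; rewrite /acons; case: unliftP => [j _|_].
    by exists (Var L j).
  by exists (tzero n).
have [|h _] := dnf_formula (f := fun x y => acons x y) qp.
  move=> i; rewrite /acons; case: unliftP => [j _|_].
    by exists (Var L j), 0%N, 0%N => x y _; rewrite expr0 divr1 mulr1.
  by exists (tone n), 1%N, 0%N => x y _; rewrite expr0 divr1 mul1r.
apply: qf_ext (qf_or at0 (qf_exists_dnf h)) => y; split.
  by move=> [/pP|[x _ /pP]]; [exists 0|exists x].
move=> [x /pP Px]; have [x0|x0] := eqVneq x 0; first by left; rewrite -x0.
by right; exists x.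
Qed.

Lemma qf_sat n (p : formula L n) : qf_definable (fun y => sat (M := M) p y).
Proof.
elim: p => {n} [n|n s t|n []|n p IH|n p IHp q IHq|n p IHp q IHq|n p IHp q IHq
    |n p IH|n p IH] /=.
- exact: qf_false.
- exact: qf_eq.
- exact: qf_not.
- exact: qf_and.
- exact: qf_or.
- exact: qf_imp.
- apply: qf_ext (qf_not (qf_exists (qf_not IH))) => y; split.
    by move=> h x; apply: contrapT => hx; apply: h; exists x.
  by move=> h [x]; apply.
- exact: qf_exists.
Qed.

End Elimination.

(** * Transfer to all models of the theory *)

Fixpoint universal_closure (L : language) n : formula L n -> sentence L :=
  match n with
  | 0 => id
  | n'.+1 => fun p => universal_closure (All p)
  end.

Lemma acons_head_tail (M : Type) n (e : assignment M n.+1) :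
  acons (e ord0) (e \o lift ord0) = e.
Proof. by apply: funext => i; rewrite /acons; case: unliftP => [j|] ->. Qed.

Lemma models_universal_closure (L : language) (M : structure L) n
    (p : formula L n) :
  models M (universal_closure p) <-> forall e : assignment M n, sat p e.
Proof.
elim: n p => [|n IH] p //=; rewrite IH /=; split=> [h e|h e x]; last exact: h.
by rewrite -(acons_head_tail e).
Qed.

Theorem theorem10 (R : realType) : admits_QE (theory_of (cmul_structure R)).
Proof.
move=> n p; have [q qf qp] := qf_sat R p; exists q; split=> // N NT.
(* The universal closure of [Iff p q] is a sentence true in the complex numbers, hence in the theory
   and true in [N]. *)
apply/models_universal_closure/NT/models_universal_closure => e /=.
by rewrite qp.
Qed.
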